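(* Let $R$ be a commutative ring. The assignment $(G,L)\mapsto\Upsilon(G,L)$ is a (covariant) functor from the category of $R$-networks to the category of $R$-modules, where an $R$-network morphism $f:(G_1,L_1)\to(G_2,L_2)$ is sent to the (well-defined) $R$-linear map \[ \Upsilon f:\Upsilon(G_1,L_1)\to\Upsilon(G_2,L_2),\qquad x+L_1(RV_1^\circ)\mapsto f(x)+L_2(RV_2^\circ)\quad(x\in V_1). \]
   Context: A graph is a countable, locally finite, undirected multigraph with vertex set $V$ and set $E$ of oriented edges (each undirected edge gives $e$ and its reverse $\overline{e}$); $e_+$, $e_-$ are the starting and ending vertices of $e$, and $\mathcal{E}(x)=\{e: e_+=x\}$. A $\partial$-graph is a graph with a partition $V=V^\circ\sqcup\partial V$ (interior and boundary vertices). A generalized Laplacian over $R$ is an $R$-linear map $L:RV\to RV$, $Lx=d(x)x+\sum_{e\in\mathcal{E}(x)}w(e)(x-e_-)$, with $w:E\to R$, $w(\overline{e})=w(e)$, and $d:V\to R$. An $R$-network is a pair $(G,L)$. $\Upsilon(G,L)=RV/L(RV^\circ)$, where $RV$, $RV^\circ$ are free modules on $V$, $V^\circ$. A $\partial$-graph morphism $f:G_1\to G_2$ is a map $f:V_1\sqcup E_1\to V_2\sqcup E_2$ such that: (1) $f$ maps vertices to vertices; (2) $f$ maps interior vertices to interior vertices; (3) if $f(e)$ is an oriented edge then $f(e_\pm)=f(e)_\pm$ and $f(\overline{e})=\overline{f(e)}$; (4) if $f(e)$ is a vertex then $f(\overline{e})=f(e)$ and $f(e_\pm)=f(e)$; (5)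 for every $x\in V_1^\circ$ the restricted map $\mathcal{E}(x)\cap f^{-1}(E_2)\to\mathcal{E}(f(x))$ is $n$-to-$1$ for some integer $n\ge0$ depending on $x$; this integer is $\deg(f,x)$ (if $\mathcal{E}(f(x))=\varnothing$, any $n\geq 0$ is admissible). An $R$-network morphism $f:(G_1,L_1)\to(G_2,L_2)$ is a $\partial$-graph morphism $f:G_1\to G_2$ with $w_1(e)=w_2(f(e))$ for every $e\in f^{-1}(E_2)$ and $d_1(x)=\deg(f,x)\,d_2(f(x))$ for every $x\in V_1^\circ$. *)

(* Defs.v *)
From HB Require Import structures.
From mathcomp Require Import all_boot all_order all_algebra.
From mathcomp Require Import finmap monalg.
From mathcomp Require Import boolp.

Set Implicit Arguments.
Unset Strict Implicit.
Unset Printing Implicit Defensive.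

Import GRing.Theory.
Local Open Scope fset_scope.
Local Open Scope ring_scope.
Local Open Scope quotient_scope.

(* An edge e stands for one orientation of an undirected edge, so loops also
   give two distinct edges e and rev e. Local finiteness is the existence of the
   finite set star x = E(x), which the axiom star_start determines uniquely. *)
Record graph := Graph {
  vertex : countType;
  edge : countType;
  start : edge -> vertex;
  rev : edge -> edge;
  star : vertex -> {fset edge};
  revK : involutive rev;
  rev_neq : forall e, rev e != e;
  star_start : forall x e, (e \in star x) = (start e == x)
}.
Arguments start {_} _.
Arguments rev {_} _.
Arguments star {_} _.

Definition finish (G : graph) (e : edge G) : vertex G := start (rev e).

(* The boundary is the complement of interior. *)
Record dgraph := DGraph {
  dgraph_graph :> graph;
  interior : pred (vertex dgraph_graph)
}.
Arguments interior {_} _.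

(* n-to-1-ness of the restriction of fe to E(x) \cap f^{-1}(E_2); every n is
   admissible when E(fv x) is empty. *)
Definition n_to_one (G1 G2 : graph) (fv : vertex G1 -> vertex G2)
    (fe : edge G1 -> vertex G2 + edge G2) (x : vertex G1) (n : nat) : Prop :=
  forall e', e' \in star (fv x) ->
    #|` [fset e in star x | fe e == inr e'] | = n.

(* A map V_1 + E_1 -> V_2 + E_2 sending vertices to vertices, given by its
   restrictions to V_1 and to E_1. *)
Record dgraph_morph (G1 G2 : dgraph) := DGraphMorph {
  vmap :> vertex G1 -> vertex G2;
  emap : edge G1 -> vertex G2 + edge G2;
  vmap_interior : forall x, interior x -> interior (vmap x);
  emap_edge : forall e e', emap e = inr e' ->
    [/\ vmap (start e) = start e', vmap (finish e) = finish e'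
      & emap (rev e) = inr (rev e')];
  emap_vertex : forall e y, emap e = inl y ->
    [/\ emap (rev e) = inl y, vmap (start e) = y & vmap (finish e) = y];
  emap_n_to_one : forall x, interior x -> exists n, n_to_one vmap emap x n
}.

(* n is a value of deg(f, x): unique unless E(f x) is empty. *)
Definition is_deg (G1 G2 : dgraph) (f : dgraph_morph G1 G2) (x : vertex G1)
  (n : nat) : Prop := n_to_one f (emap f) x n.

(* The operator L alone determines neither the weights of loops nor those of
   parallel edges, so a network carries w and d. *)
Record network (R : comPzRingType) := Network {
  network_dgraph :> dgraph;
  weight : edge network_dgraph -> R;
  potential : vertex network_dgraph -> R;
  weight_rev : forall e, weight (rev e) = weight e
}.
Arguments weight {R _} _.
Arguments potential {R _} _.

Record network_morph (R : comPzRingType) (N1 N2 : network R) := NetworkMorph {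
  morph_dgraph :> dgraph_morph N1 N2;
  morph_weight : forall e e', emap morph_dgraph e = inr e' ->
    weight e = weight e';
  morph_potential : forall x, interior x ->
    exists2 n, is_deg morph_dgraph x n
      & potential x = n%:R * potential (morph_dgraph x)
}.


Lemma dgraph_morph_ext (G1 G2 : dgraph) (f g : dgraph_morph G1 G2) :
  vmap f =1 vmap g -> emap f =1 emap g -> f = g.
Proof.
case: f g => [fv fe f1 f2 f3 f4] [gv ge g1 g2 g3 g4] /= /funext ev /funext ee.
by case: _ / ev in g1 g2 g3 g4 *; case: _ / ee in g2 g3 g4 *;
  congr DGraphMorph; exact: Prop_irrelevance.
Qed.

Lemma network_morph_ext (R : comPzRingType) (N1 N2 : network R)
    (f g : network_morph N1 N2) :
  vmap f =1 vmap g -> emap f =1 emap g -> f = g.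
Proof.
case: f g => [f f1 f2] [g g1 g2] /= ev ee.
have e := dgraph_morph_ext ev ee.
by case: _ / e in g1 g2 *; congr NetworkMorph; exact: Prop_irrelevance.
Qed.

Lemma linear_ext (R : pzRingType) (U V : lmodType R) (f g : {linear U -> V}) :
  f =1 g -> f = g.
Proof.
case: f g => [f [[f1] [f2]]] [g [[g1] [g2]]] /= /funext e.
by case: _ / e in g1 g2 *; rewrite (Prop_irrelevance g1 f1)
  (Prop_irrelevance g2 f2).
Qed.

Section MorphismComposition.
Variables (G1 G2 G3 : dgraph) (g : dgraph_morph G2 G3) (f : dgraph_morph G1 G2).

Definition emap_comp (e : edge G1) : vertex G3 + edge G3 :=
  match emap f e with
  | inl y => inl (g y)
  | inr e' => emap g e'
  end.

Lemma emap_comp_edge e e' : emap_comp e = inr e' ->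
  [/\ g (f (start e)) = start e', g (f (finish e)) = finish e'
    & emap_comp (rev e) = inr (rev e')].
Proof.
rewrite /emap_comp; case E: (emap f e) => [//|e2] /emap_edge[gs gf gr].
by have [-> -> ->] := emap_edge E; split.
Qed.

Lemma emap_comp_vertex e y : emap_comp e = inl y ->
  [/\ emap_comp (rev e) = inl y, g (f (start e)) = y & g (f (finish e)) = y].
Proof.
rewrite /emap_comp; case E: (emap f e) => [y2|e2].
  by case=> <-; have [-> -> ->] := emap_vertex E.
by move=> /emap_vertex[gr gs gf]; have [-> -> ->] := emap_edge E.
Qed.

Lemma n_to_one_comp x n m : n_to_one f (emap f) x n ->
  n_to_one g (emap g) (f x) m -> n_to_one (g \o f) emap_comp x (n * m).
Proof.
move=> fn gm e3 /gm <-; rewrite mulnC.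
set B := [fset e in star (f x) | _]; set A := [fset e in star x | _].
have AE : A = \bigcup_(b <- B) [fset e in star x | emap f e == inr b].
  apply/fsetP=> e; apply/idP/bigfcupP.
    rewrite !inE /= => /andP[ex]; rewrite /emap_comp.
    case E: (emap f e) => [//|e2] ge; exists e2; last by rewrite !inE E ex /=.
    rewrite !inE ge !andbT star_start; have [<- _ _] := emap_edge E.
    by move: ex; rewrite star_start => /eqP->.
  case=> b; rewrite !inE /= !andbT => /andP[_ gb] /andP[-> /eqP eb].
  by rewrite /emap_comp eb.
rewrite AE; have: {subset B <= star (f x)} by move=> b; rewrite !inE => /andP[].
elim/finSet_rect: B {AE} => B IH sB.
have [->|[b bB]] := fset_0Vmem B; first by rewrite big_seq_fset0 cardfs0.
rewrite (big_fsetD1 b) //= cardfsU (fn b) ?sB // (cardfsD1 b B) bB mulnDl mul1n.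
rewrite (_ : _ `&` _ = fset0) ?cardfs0 ?subn0; last first.
  apply/fsetP=> e; rewrite in_fsetI in_fset0; apply/negP=> /andP[].
  rewrite !inE /= => /andP[_ /eqP eb] /bigfcupP[c].
  by rewrite !inE /= eb => /andP[/andP[cb _] _] /andP[_ /eqP[bc]]; rewrite bc eqxx in cb.
rewrite IH ?fproperD1 // => c; rewrite inE => /andP[_ ]; exact: sB.
Qed.

Definition dgraph_comp : dgraph_morph G1 G3.
Proof.
apply: (@DGraphMorph G1 G3 (g \o f) emap_comp).
- by move=> x /(vmap_interior f); apply: vmap_interior.
- exact: emap_comp_edge.
- exact: emap_comp_vertex.
- move=> x xi; have [n fn] := emap_n_to_one f xi.
  have [m gm] := emap_n_to_one g (vmap_interior f xi).
  by exists (n * m)%N; apply: n_to_one_comp.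
Defined.

End MorphismComposition.

Lemma n_to_one_id (G : graph) (x : vertex G) : n_to_one id inr x 1.
Proof.
move=> e' xe'; rewrite (_ : [fset _ in _ | _] = [fset e']) ?cardfs1 //.
apply/fsetP=> e; rewrite !inE /= (inj_eq inr_inj).
by apply: andb_idl => /eqP->.
Qed.

Definition dgraph_id (G : dgraph) : dgraph_morph G G.
Proof.
apply: (@DGraphMorph G G id inr) => //.
- by move=> e e' [<-].
- by move=> x _; exists 1%N; apply: n_to_one_id.
Defined.

Definition network_comp (R : comPzRingType) (N1 N2 N3 : network R)
  (g : network_morph N2 N3) (f : network_morph N1 N2) : network_morph N1 N3.
Proof.
apply: (@NetworkMorph R N1 N3 (dgraph_comp g f)).
- move=> e e3; rewrite /= /emap_comp; case E: (emap f e) => [y|e2] //.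
  by move=> /(@morph_weight _ _ _ g) <-; exact: (morph_weight E).
- move=> x xi; have [n fn ->] := morph_potential f xi.
  have [m gm ->] := morph_potential g (vmap_interior f xi).
  by exists (n * m)%N; [apply: n_to_one_comp | rewrite natrM mulrA].
Defined.

Definition network_id (R : comPzRingType) (N : network R) : network_morph N N.
Proof.
apply: (@NetworkMorph R N N (dgraph_id N)) => [e e' [->] //|x _].
by exists 1%N; [apply: n_to_one_id | rewrite mul1r].
Defined.

Record category := Category {
  object :> Type;
  arrow : object -> object -> Type;
  identity : forall A, arrow A A;
  compose : forall A B C, arrow B C -> arrow A B -> arrow A C;
  compose1l : forall A B (f : arrow A B), compose (identity B) f = f;
  compose1r : forall A B (f : arrow A B), compose f (identity A) = f;
  composeA : forall A B C D (h : arrow C D) (g : arrow B C) (f : arrow A B),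
    compose h (compose g f) = compose (compose h g) f
}.
Arguments arrow {_} _ _.
Arguments identity {_} _.
Arguments compose {_ _ _ _} _ _.

Definition is_functor (C D : category) (F0 : C -> D)
    (F1 : forall A B, arrow A B -> arrow (F0 A) (F0 B)) : Prop :=
  (forall A, F1 A A (identity A) = identity (F0 A)) /\
  (forall A B C (g : arrow B C) (f : arrow A B),
    F1 A C (compose g f) = compose (F1 B C g) (F1 A B f)).

Definition network_category (R : comPzRingType) : category.
Proof.
apply: (@Category (network R) (@network_morph R) (@network_id R)
  (@network_comp R)).
- move=> N1 N2 f; apply: network_morph_ext => //= e.
  by rewrite /emap_comp /=; case: (emap f e).
- by move=> N1 N2 f; apply: network_morph_ext.
- move=> N1 N2 N3 N4 h g f; apply: network_morph_ext => //= e.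
  by rewrite /emap_comp /= /emap_comp; case: (emap f e).
Defined.

Definition module_category (R : comPzRingType) : category.
Proof.
apply: (@Category (lmodType R) (fun U V => {linear U -> V})
  (fun U => idfun : {linear U -> U})
  (fun U V W g f => g \o f : {linear U -> W})).
- by move=> U V f; apply: linear_ext.
- by move=> U V f; apply: linear_ext.
- by move=> U V W X h g f; apply: linear_ext.
Defined.

(* monalg only provides scaling on {malg R[V]} for nonzero rings R. *)
Section FreeModule.
Variables (R : pzRingType) (V : choiceType).

Definition freemod : Type := {malg R[V]}.
HB.instance Definition _ := GRing.Zmodule.on freemod.
Implicit Types (a b : freemod).

Definition freemod_scale (c : R) a : freemod :=
  [malg x in msupp a => c * a@_x].

Lemma freemod_scaleE c a x : (freemod_scale c a)@_x = c * a@_x.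
Proof. by rewrite mcoeffE; case: msuppP; rewrite ?mulr0. Qed.

Lemma freemod_scaleA c1 c2 a :
  freemod_scale c1 (freemod_scale c2 a) = freemod_scale (c1 * c2) a.
Proof. by apply/malgP=> x; rewrite !freemod_scaleE mulrA. Qed.

Lemma freemod_scale1 : left_id 1 freemod_scale.
Proof. by move=> a; apply/malgP=> x; rewrite freemod_scaleE mul1r. Qed.

Lemma freemod_scaleDr : right_distributive freemod_scale +%R.
Proof.
by move=> c a b; apply/malgP=> x; rewrite !(mcoeffD, freemod_scaleE) mulrDr.
Qed.

Lemma freemod_scaleDl a : {morph freemod_scale^~ a : c1 c2 / c1 + c2}.
Proof.
by move=> c1 c2; apply/malgP=> x; rewrite !(mcoeffD, freemod_scaleE) mulrDl.
Qed.

HB.instance Definition _ := GRing.Zmodule_isLmodule.Build R freemod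
  freemod_scaleA freemod_scale1 freemod_scaleDr freemod_scaleDl.

Definition basis (x : V) : freemod := << (1 : R) *g x >>.

Section Extension.
Variables (M : lmodType R) (f : V -> M).

Definition freemod_lift a : M := \sum_(x <- msupp a) a@_x *: f x.

Lemma freemod_liftEw a (D : {fset V}) : msupp a `<=` D ->
  freemod_lift a = \sum_(x <- D) a@_x *: f x.
Proof.
move=> aD; apply: big_fset_incl => // x _.
by move=> /mcoeff_outdom ->; rewrite scale0r.
Qed.

Lemma freemod_lift_is_linear : linear freemod_lift.
Proof.
move=> c a b; pose D := msupp (c *: a + b) `|` (msupp a `|` msupp b).
rewrite !(@freemod_liftEw _ D) ?fsubsetUl //; first last.
- by rewrite fsubsetU // fsubsetUl orbT.
- by rewrite fsubsetU // fsubsetUr orbT.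
rewrite scaler_sumr -big_split /=; apply: eq_bigr => x _.
by rewrite mcoeffD freemod_scaleE scalerDl scalerA.
Qed.

HB.instance Definition _ := GRing.isLinear.Build R freemod M *:%R freemod_lift
  freemod_lift_is_linear.

End Extension.
End FreeModule.

Section Upsilon.
Variables (R : comPzRingType) (N : network R).
Local Notation RV := (freemod R (vertex N)).

Definition laplacian_vertex (x : vertex N) : RV :=
  potential x *: basis R x +
  \sum_(e <- star x) weight e *: (basis R x - basis R (finish e)).

Definition laplacian : {linear RV -> RV} := freemod_lift laplacian_vertex.

(* RV^o is the submodule of RV of the elements supported in V^o. *)
Definition interior_mod (a : RV) : bool := all interior (msupp a).

(* Membership in L(RV^o). *)
Definition laplacian_image : {pred RV} :=
  fun b => `[< exists2 a, interior_mod a & b = laplacian a >].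

Lemma laplacian_image_submod : submod_closed laplacian_image.
Proof.
split=> [|c b1 b2]; rewrite ?inE.
  by apply/asboolP; exists 0; rewrite ?raddf0 // /interior_mod msupp0.
move=> /asboolP[a1 i1 ->] /asboolP[a2 i2 ->]; apply/asboolP.
exists (c *: a1 + a2); last by rewrite linearP.
apply/allP=> x; rewrite -mcoeff_neq0 mcoeffD freemod_scaleE.
have [/(allP i1) //|_] := msuppP a1; have [/(allP i2) //|_] := msuppP a2.
by rewrite mulr0 addr0 eqxx.
Qed.

HB.instance Definition _ := GRing.isZmodClosed.Build RV laplacian_image
  (GRing.submod_closedB laplacian_image_submod).

Definition Upsilon : Type := Quotient.quot laplacian_image.
HB.instance Definition _ := GRing.Zmodule.on Upsilon.
HB.instance Definition _ := Quotient.on Upsilon.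

Definition upsilon_class (a : RV) : Upsilon := \pi_Upsilon a.

Lemma upsilon_classE a b :
  (upsilon_class a == upsilon_class b) = (a - b \in laplacian_image).
Proof. by rewrite Quotient.idealrBE. Qed.

Definition upsilon_scale (c : R) (u : Upsilon) : Upsilon :=
  upsilon_class (c *: repr u).

Lemma upsilon_scale_class c a :
  upsilon_scale c (upsilon_class a) = upsilon_class (c *: a).
Proof.
apply/eqP; rewrite upsilon_classE -scalerBr.
have [im0 imL] := laplacian_image_submod.
rewrite -[_ *: _]addr0; apply: imL => //.
by rewrite -upsilon_classE /upsilon_class reprK.
Qed.

Lemma upsilon_classP (u : Upsilon) : {a | u = upsilon_class a}.
Proof. by exists (repr u); rewrite /upsilon_class reprK. Qed.

Lemma upsilon_scaleA c1 c2 u :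
  upsilon_scale c1 (upsilon_scale c2 u) = upsilon_scale (c1 * c2) u.
Proof.
by have [a ->] := upsilon_classP u; rewrite !upsilon_scale_class scalerA.
Qed.

Lemma upsilon_scale1 : left_id 1 upsilon_scale.
Proof.
by move=> u; have [a ->] := upsilon_classP u; rewrite upsilon_scale_class scale1r.
Qed.

Lemma upsilon_classD : {morph upsilon_class : a b / a + b}.
Proof. by move=> a b; rewrite /upsilon_class !piE. Qed.

Lemma upsilon_scaleDr : right_distributive upsilon_scale +%R.
Proof.
move=> c u v; have [a ->] := upsilon_classP u; have [b ->] := upsilon_classP v.
by rewrite -upsilon_classD !upsilon_scale_class scalerDr upsilon_classD.
Qed.

Lemma upsilon_scaleDl u : {morph upsilon_scale^~ u : c1 c2 / c1 + c2}.
Proof.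
move=> c1 c2; have [a ->] := upsilon_classP u.
by rewrite !upsilon_scale_class scalerDl upsilon_classD.
Qed.

HB.instance Definition _ := GRing.Zmodule_isLmodule.Build R Upsilon
  upsilon_scaleA upsilon_scale1 upsilon_scaleDr upsilon_scaleDl.

Lemma upsilon_class_is_linear : linear upsilon_class.
Proof. by move=> c a b; rewrite upsilon_classD -upsilon_scale_class. Qed.

HB.instance Definition _ := GRing.isLinear.Build R RV Upsilon *:%R upsilon_class
  upsilon_class_is_linear.

End Upsilon.

(* Main.v *)
From HB Require Import structures.
Require Import Defs.
From mathcomp Require Import all_boot all_order all_algebra.
From mathcomp Require Import finmap monalg boolp.

(** A network morphism [f : N1 -> N2] extends to a linear map
    [f_* : RV_1 -> RV_2] on free modules.  Everything rests on the identity
    [f_* (L_1 x) = deg(f, x) L_2 (f x)] for interior [x]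
    ([pushforward_laplacian_vertex]): in [f_* (L_1 x)] an edge collapsed to a
    vertex contributes [f x - f x = 0], while each edge [e'] leaving [f x] is
    the image of exactly [deg(f, x)] edges leaving [x], all of the same weight
    as [e'] and all contributing [w(e') (f x - e'_-)]; the potentials match by
    assumption.  (If no edge leaves [f x], the degree is not unique, and the
    identity holds for any value with matching potentials.)  As [f x] is again interior, [f_*] maps [L_1(RV_1^o)] into
    [L_2(RV_2^o)] and descends to the quotients.

    The classes of the vertices generate [Upsilon], so a linear map out of
    [Upsilon] is determined by its values on them ([upsilon_linear_ext]).  This
    gives uniqueness, and also functoriality, since both sides of each functor
    law have the same values on classes of vertices. *)

Set Implicit Arguments.
Unset Strict Implicit.
Unset Printing Implicit Defensive.

Import GRing.Theory.
Local Open Scope fset_scope.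
Local Open Scope ring_scope.

Lemma freemod_lift_basis (R : pzRingType) (V : choiceType) (M : lmodType R)
  (f : V -> M) (x : V) : freemod_lift f (basis R x) = f x.
Proof.
have sx : msupp (basis R x : {malg R[V]}) `<=` [fset x] by exact: msuppU_le.
by rewrite (freemod_liftEw f sx) big_seq_fset1 mcoeffUU scale1r.
Qed.

Lemma freemod_basisE (R : pzRingType) (V : choiceType) (a : freemod R V) :
  a = \sum_(x <- msupp a) (a@_x *: basis R x : freemod R V).
Proof.
rewrite [LHS]monalgE; apply: eq_bigr => x _.
by apply/malgP => y; rewrite freemod_scaleE !mcoeffU mulrnAr mulr1.
Qed.

Section Pushforward.
Variables (R : comPzRingType) (N1 N2 : network R) (f : network_morph N1 N2).
Local Notation RV1 := (freemod R (vertex N1)).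
Local Notation RV2 := (freemod R (vertex N2)).

(** The linear extension [f_* : RV_1 -> RV_2] of [f] on vertices. *)
Definition pushforward : {linear RV1 -> RV2} :=
  freemod_lift (fun x => basis R (f x)).

Lemma pushforward_basis x : pushforward (basis R x) = basis R (f x).
Proof. exact: freemod_lift_basis. Qed.

(** A sum over the edges at [x] that are not collapsed by [f] is [n] times the
    sum over the edges at [f x] when [f] is [n]-to-1 at [x]. *)
Lemma sum_star_n_to_one (M : lmodType R) (F : edge N2 -> M) x n :
  is_deg f x n ->
  \sum_(e <- star x) (if emap f e is inr e' then F e' else 0) =
  n%:R *: \sum_(e' <- star (f x)) F e'.
Proof.
move=> fn; rewrite scaler_sumr.
(* Each term is the sum over the e' at f x of the F e' with f e = e'; the two
   summations are then exchanged. *)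
transitivity (\sum_(e <- star x) \sum_(e' <- star (f x))
    (if emap f e == inr e' then F e' else 0)).
  rewrite !big_seq; apply: eq_bigr => e; rewrite star_start => /eqP ex.
  case E: (emap f e) => [y|e2]; first by rewrite big1.
  have [fe _ _] := emap_edge E.
  have e2x : e2 \in star (f x) by rewrite star_start -fe ex.
  rewrite (big_fsetD1 e2) //= eqxx big_seq big1 ?addr0 // => e'.
  rewrite !inE => /andP[ne _].
  by rewrite (inj_eq inr_inj) eq_sym (negbTE ne).
rewrite exchange_big /= !big_seq; apply: eq_bigr => e' ex'.
rewrite -big_mkcond /= -(fn _ ex') scaler_nat.
by rewrite big_fset_condE /= big_const_seq count_predT iter_addr_0.
Qed.

Lemma pushforward_laplacian_vertex x n : is_deg f x n ->
    potential x = n%:R * potential (f x) ->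
  pushforward (laplacian_vertex x) = n%:R *: laplacian_vertex (f x).
Proof.
move=> fn dx; rewrite /laplacian_vertex linearD linearZ /= pushforward_basis.
rewrite scalerDr scalerA -dx linear_sum -sum_star_n_to_one //; congr (_ + _).
rewrite !big_seq; apply: eq_bigr => e; rewrite star_start => /eqP ex.
rewrite linearZ linearB /= !pushforward_basis.
case E: (emap f e) => [y|e'].
  by have [_ <- ->] := emap_vertex E; rewrite ex subrr scaler0.
by have [_ -> _] := emap_edge E; rewrite (morph_weight E).
Qed.

Lemma laplacian_vertex_image (N : network R) (x : vertex N) :
  interior x -> laplacian_vertex x \in @laplacian_image R N.
Proof.
move=> xi; apply/asboolP; exists (basis R x); last first.
  by rewrite /laplacian /= freemod_lift_basis.
apply/allP => y /(fsubsetP msuppU_le).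
by rewrite inE => /eqP->.
Qed.

Lemma pushforward_laplacian_image a : a \in @laplacian_image R N1 ->
  pushforward a \in @laplacian_image R N2.
Proof.
move=> /asboolP[{}a ai ->].
have [im0 imL] := @laplacian_image_submod R N2.
have -> : laplacian N1 a = \sum_(x <- msupp a) a@_x *: laplacian_vertex x by [].
rewrite linear_sum big_seq.
elim/big_rec: _ => // x b xa bi; rewrite linearZ /=.
have xi : interior x by exact: (allP ai).
have [n fn dx] := morph_potential f xi.
rewrite (pushforward_laplacian_vertex fn dx) scalerA; apply: imL => //.
exact/laplacian_vertex_image/vmap_interior.
Qed.

(** The map [Upsilon f], evaluated on a chosen representative of the class. *)
Definition upsilon_map (u : Upsilon N1) : Upsilon N2 :=
  upsilon_class (pushforward (repr u)).

Lemma upsilon_map_class a :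
  upsilon_map (upsilon_class a) = upsilon_class (pushforward a).
Proof.
apply/eqP; rewrite upsilon_classE -linearB; apply: pushforward_laplacian_image.
by rewrite -upsilon_classE /upsilon_class reprK.
Qed.

Lemma upsilon_map_is_linear : linear upsilon_map.
Proof.
move=> c u v; have [a ->] := upsilon_classP u; have [b ->] := upsilon_classP v.
by rewrite -linearP !upsilon_map_class !linearP.
Qed.

HB.instance Definition _ := GRing.isLinear.Build R (Upsilon N1) (Upsilon N2)
  *:%R upsilon_map upsilon_map_is_linear.

Lemma upsilon_map_basis x :
  upsilon_map (upsilon_class (basis R x)) = upsilon_class (basis R (f x)).
Proof. by rewrite upsilon_map_class pushforward_basis. Qed.

End Pushforward.

Lemma upsilon_linear_ext (R : comPzRingType) (N : network R) (M : lmodType R)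
    (phi psi : {linear Upsilon N -> M}) :
  (forall x, phi (upsilon_class (basis R x)) =
             psi (upsilon_class (basis R x))) -> phi = psi.
Proof.
move=> eq_vertex; apply: linear_ext => u; have [a ->] := upsilon_classP u.
rewrite [a]freemod_basisE !linear_sum; apply: eq_bigr => x _.
by rewrite !linearZ /= eq_vertex.
Qed.

Theorem lemma4p9 (R : comPzRingType) :
  exists Umap : forall N1 N2 : network R,
      network_morph N1 N2 -> {linear Upsilon N1 -> Upsilon N2},
    @is_functor (network_category R) (module_category R) (@Upsilon R) Umap /\
    forall (N1 N2 : network R) (f : network_morph N1 N2),
      unique (fun phi : {linear Upsilon N1 -> Upsilon N2} =>
        forall x : vertex N1,
          phi (upsilon_class (basis R x)) = upsilon_class (basis R (f x)))
        (Umap N1 N2 f).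
Proof.
exists (fun N1 N2 f => upsilon_map f : {linear Upsilon N1 -> Upsilon N2}).
split; first split.
- by move=> N; apply: upsilon_linear_ext => x; exact: upsilon_map_basis.
- move=> N1 N2 N3 g f; apply: upsilon_linear_ext => x.
  by rewrite /= !upsilon_map_basis.
- move=> N1 N2 f; split=> [x|phi phi_vertex]; first exact: upsilon_map_basis.
  apply: upsilon_linear_ext => x; rewrite phi_vertex; exact: upsilon_map_basis.
Qed.
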